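(* Let $\mathcal{C}=\langle(x^n-\lambda_0)^\nu\rangle$ be a $\lambda$-constacyclic code of length $np^s$ over $\mathcal{R}_e$, where $0\le\nu\le ep^s$. Then the Hamming distance $d_H(\mathcal{C})$ of $\mathcal{C}$ is given by $$d_H(\mathcal{C})=\begin{cases}1&\text{if }0\le\nu\le(e-1)p^s;\\ \ell+2&\text{if }(e-1)p^s+\ell p^{s-1}+1\le\nu\le(e-1)p^s+(\ell+1)p^{s-1}\text{ with }0\le\ell\le p-2;\\(i+1)p^k&\text{if }ep^s-p^{s-k}+(i-1)p^{s-k-1}+1\le\nu\le ep^s-p^{s-k}+ip^{s-k-1}\\&\quad\text{with }1\le i\le p-1\text{ and }1\le k\le s-1;\\0&\text{if }\nu=ep^s.\end{cases}$$
   Context: $e\ge2$ is an integer and $\mathcal{R}_e$ is a finite commutative chain ring with unity, with maximal ideal $\langle\gamma\rangle$ where $\gamma$ has nilpotency index $e$; its residue field $\mathcal{R}_e/\langle\gamma\rangle$ has order $p^m$, $p$ prime. $\zeta\in\mathcal{R}_e$ has multiplicative order $p^m-1$ and $\mathcal{T}_e=\{0,1,\zeta,\dots,\zeta^{p^m-2}\}$. $n,s$ are positive integers with $\gcd(n,p)=1$. $\lambda=\lambda_0^{p^s}+\gamma\omega$ is a unit of $\mathcal{R}_e$, where $\lambda_0\in\mathcal{T}_e\setminus\{0\}$ is such that $x^n-\lambda_0$ is irreducible over $\mathcal{R}_e$, and $\omega$ is a unit in $\mathcal{R}_e$. $\lambda$-constacyclic codes of length $np^s$ over $\mathcal{R}_e$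 are identified with ideals of $\mathcal{R}_e[x]/\langle x^{np^s}-\lambda\rangle$, whose elements are represented by polynomials of degree less than $np^s$. The Hamming weight $w_H(c(x))$ is the number of nonzero coefficients of $c(x)$, and $d_H(\mathcal{C})=\min\{w_H(c):c\in\mathcal{C}\setminus\{0\}\}$, with $d_H(\{0\})=0$. *)

(* Defs.v *)
From HB Require Import structures.
From mathcomp Require Import all_boot all_order all_algebra.

Set Implicit Arguments.
Unset Strict Implicit.
Unset Printing Implicit Defensive.

Import GRing.Theory.
Local Open Scope ring_scope.

(* The library's [idealr_closed] only covers proper ideals, whereas the unit
   ideal is needed both for chain rings and for codes. *)
Definition is_ideal (A : finComNzRingType) (I : {set A}) : Prop :=
  0 \in I /\ forall a, {in I &, forall u v, a * u + v \in I}.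

Definition principal_ideal (A : finComNzRingType) (g : A) : {set A} :=
  [set g * a | a : A].

Definition maximal_ideal (A : finComNzRingType) (I : {set A}) : Prop :=
  [/\ is_ideal I, I != setT &
      forall J : {set A}, is_ideal J -> I \subset J -> J = I \/ J = setT].

Definition chain_ring (A : finComNzRingType) : Prop :=
  forall I J : {set A}, is_ideal I -> is_ideal J -> I \subset J \/ J \subset I.

Definition nilpotency_index (A : finComNzRingType) (g : A) (e : nat) : Prop :=
  g ^+ e = 0 /\ forall j, (j < e)%N -> g ^+ j != 0.

(* The underlying set of A / I: the cosets a + I. *)
Definition cosets (A : finComNzRingType) (I : {set A}) : {set {set A}} :=
  [set [set a + x | x in I] | a : A].

Definition teichmuller (A : finComNzRingType) (zeta : A) (q : nat) : {set A} :=
  0 |: [set zeta ^+ i | i : 'I_(q - 1)].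

(* The library's [irreducible_poly] requires coefficients in an integral domain
   and its [poly] unit predicate does too; over a chain ring {poly A} has
   non-constant units, so irreducibility is the ring-theoretic notion. *)
Definition poly_is_unit (A : comNzRingType) (f : {poly A}) : Prop :=
  exists g, f * g = 1.

Definition irreducible_over (A : comNzRingType) (f : {poly A}) : Prop :=
  [/\ f != 0, ~ poly_is_unit f &
      forall g h, f = g * h -> poly_is_unit g \/ poly_is_unit h].

(* The library provides the finite and the ring structure of {poly %/ h}
   separately; this joins them. *)
HB.instance Definition _ (A : finComNzRingType) (h : {poly A}) :=
  Finite.on {poly %/ h}.

(* A[x] / <x^N - lam>; elements are polynomials of size at most N, i.e. of
   degree less than N.  For N = 0 the library would quotient by 'X instead. *)
Notation constacyclic_ring A N lam := {poly %/ ('X^N - lam%:P : {poly A})}.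

Definition hamming_weight (A : nzRingType) (c : {poly A}) : nat :=
  count (fun a : A => a != 0) c.

Definition hamming_distance (A : finComNzRingType) (h : {poly A})
    (C : {set {poly %/ h}}) : nat :=
  if [pick c in C :\ 0] is Some c0
  then hamming_weight [arg min_(c < c0 in C :\ 0) hamming_weight c]
  else 0%N.

(* Main.v *)
Require Import Defs.
From HB Require Import structures.
From mathcomp Require Import all_boot all_order all_algebra.
From mathcomp Require Import ring zify.

Set Implicit Arguments.
Unset Strict Implicit.
Unset Printing Implicit Defensive.

Import GRing.Theory.
Local Open Scope ring_scope.

(** Write f = x^n - lambda0, q = p^s and S = R[x] / <x^(n q) - lambda>.

    In S the element f^q is gamma times a unit.  Indeed
    x^(n q) = (f + lambda0)^q = f^q + lambda0^q + p f k for some k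
    ([exprD_prime_pow]), and x^(n q) = lambda0^q + gamma omega in S; as p is a
    multiple of gamma this reads f^q = gamma (omega - f k'), where omega is a
    unit and f is nilpotent ([constacyclic_generator_pow]).  This is where the
    hypothesis that omega is a unit enters.  Hence f^((e-1) q) is gamma^(e-1)
    times a unit and f^(e q) = 0; in particular <f^nu> contains gamma^(e-1), a
    word of weight 1, as soon as nu <= (e-1) q.

    For nu = (e-1) q + j the code is gamma^(e-1) <f^j>.  Multiplication by
    gamma^(e-1) kills exactly the multiples of gamma
    ([socle_annihilator]), so weights can be read after reduction to the
    residue field F: the code has the weights of the multiples of
    (x^n - a)^j of degree less than n q over F, where a is the image of
    lambda0 ([scaled_codeword_residue]).

    Over F the lower bound goes by peeling off the top base-p digit of the
    multiplicity ([fold_codeword]).  Put M = n p^r and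
    g = x^M - b = (x^n - a)^(p^r), and write a word c of degree less than M p as
    g^T h with g not dividing h.  Splitting the exponents of c into residue
    classes modulo M turns c into M polynomials of degree less than p, and
    turns g into x - b.  A class where h mod g has a nonzero coefficient
    carries a zero of order exactly T at b, so by
    [hamming_weight_dvd_exp_XsubC] it has at least T + 1 nonzero coefficients.
    Thus c has weight at least T + 1 times that of h mod g, which is a word of
    the same kind of smaller degree.  The range indexed by l is that of
    k = 0 and i = l + 1.  In the range indexed by (i, k) the k leading digits
    of the multiplicity are p - 1, each giving a factor p, and what follows
    gives a factor at least i + 1 ([field_code_weight_ge]).

    The bound is attained by gamma^(e-1) times the lift to R[x] of
    (x^(n p^(r+1)) - a^(p^(r+1)))^(p^k - 1) (x^(n p^r) - a^(p^r))^i, where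
    r = s - k - 1: it reduces to a power of x^n - a over F and is a product of
    two polynomials having at most p^k and i + 1 terms ([sparse_power]). *)

(** * Hamming weights of polynomials *)

Lemma hamming_weightE (R : nzRingType) (c : {poly R}) (N : nat) :
  (size c <= N)%N -> hamming_weight c = (\sum_(0 <= i < N) (c`_i != 0)%R)%N.
Proof.
move=> cN; rewrite /hamming_weight -sum1_count big_mkcond (big_nth 0) /=.
rewrite [RHS](big_cat_nat (leq0n _) cN) /= [X in (_ + X)%N]big_nat_cond.
rewrite [X in (_ + X)%N]big1 ?addn0 => [|i /andP[/andP[ci _] _]].
  by apply: eq_bigr => i _; case: (_ != 0).
by rewrite nth_default ?eqxx.
Qed.

(** The coefficient rings may differ, so that weights can be compared before
    and after reduction to the residue field. *)
Lemma hamming_weight_le (R S : nzRingType) (c : {poly R}) (d : {poly S}) :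
  (forall i, c`_i != 0 -> d`_i != 0) -> (hamming_weight c <= hamming_weight d)%N.
Proof.
move=> cd; pose N := maxn (size c) (size d).
rewrite (hamming_weightE (leq_maxl _ _ : (_ <= N)%N)).
rewrite (hamming_weightE (leq_maxr _ _ : (_ <= N)%N)).
by apply: leq_sum => i _; have := cd i; case: (c`_i != 0) => // ->.
Qed.

Lemma hamming_weightD (R : nzRingType) (c d : {poly R}) :
  (hamming_weight (c + d)
     <= hamming_weight c + hamming_weight d)%N.
Proof.
pose N := maxn (size c) (size d).
rewrite (hamming_weightE (size_polyD _ _ : (_ <= N)%N)).
rewrite (hamming_weightE (leq_maxl _ _ : (_ <= N)%N)).
rewrite (hamming_weightE (leq_maxr _ _ : (_ <= N)%N)).
rewrite -big_split; apply: leq_sum => i _; rewrite coefD /=.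
by have [->|] := eqVneq c`_i 0; rewrite ?add0r // => _; case: (_ != 0); case: (_ != 0).
Qed.

Lemma hamming_weight0 (R : nzRingType) : hamming_weight (0 : {poly R}) = 0%N.
Proof. by rewrite /hamming_weight polyseq0. Qed.

Lemma hamming_weight_gt0 (R : nzRingType) (c : {poly R}) :
  (0 < hamming_weight c)%N = (c != 0).
Proof.
have [->|cn0] := eqVneq c 0; first by rewrite hamming_weight0.
rewrite -has_count; apply/hasP; exists (lead_coef c); last by rewrite lead_coef_eq0.
by rewrite lead_coefE mem_nth // prednK ?size_poly_gt0.
Qed.

Lemma hamming_weight_sum (R : nzRingType) (I : Type) (s : seq I) (P : pred I)
    (c : I -> {poly R}) :
  (hamming_weight (\sum_(i <- s | P i) c i)
     <= \sum_(i <- s | P i) hamming_weight (c i))%N.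
Proof.
elim/big_ind2: _ => [|c1 m1 c2 m2 le1 le2|//]; first by rewrite hamming_weight0.
exact: leq_trans (hamming_weightD _ _) (leq_add le1 le2).
Qed.

Lemma hamming_weightZXn (R : nzRingType) (a : R) (n : nat) (c : {poly R}) :
  (hamming_weight (a *: ('X^n * c)) <= (a != 0)%R * hamming_weight c)%N.
Proof.
have [->|_] := eqVneq a 0; first by rewrite scale0r hamming_weight0.
rewrite mul1n; apply: (@leq_trans (hamming_weight ('X^n * c))).
  apply: hamming_weight_le => i; rewrite coefZ.
  by apply: contraNneq => ->; rewrite mulr0.
elim: n => [|n IH]; first by rewrite mul1r.
rewrite exprS -mulrA; apply: leq_trans IH.
have [->|cn0] := eqVneq ('X^n * c) 0; first by rewrite mulr0.
by rewrite -commr_polyX /hamming_weight polyseqMX //= eqxx.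
Qed.

Lemma hamming_weightM (R : nzRingType) (c d : {poly R}) :
  (hamming_weight (c * d) <= hamming_weight c * hamming_weight d)%N.
Proof.
rewrite (hamming_weightE (leqnn (size c))) big_mkord big_distrl /=.
rewrite -[c in (hamming_weight (c * d))%R]coefK poly_def mulr_suml.
apply: leq_trans (hamming_weight_sum _ _ _) _; apply: leq_sum => i _.
by rewrite -scalerAl hamming_weightZXn.
Qed.

Lemma hamming_weight_exp_XnsubC (R : comNzRingType) (M k : nat) (a : R) :
  (hamming_weight (('X^M - a%:P) ^+ k) <= k.+1)%N.
Proof.
rewrite -polyCN exprDn; apply: leq_trans (hamming_weight_sum _ _ _) _.
rewrite -[X in (_ <= X)%N](card_ord k.+1) -sum1_card; apply: leq_sum => i _.
rewrite -rmorphXn -exprM -mulrnAr -rmorphMn mulrC mul_polyC /=.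
rewrite -['X^ _]mulr1; apply: leq_trans (hamming_weightZXn _ _ _) _.
by rewrite /hamming_weight polyseq1 /= oner_eq0 muln1 leq_b1.
Qed.

(** * Zeros of high order in degree less than p *)

(** The operator u |-> X u' - (deg u) u multiplies the coefficient of X^i by
    i - deg u.  In degrees below p it therefore deletes the leading term and
    no other, while it lowers the order of the zero at b by at most one.  Since
    a single term has no zero at b, a zero of order T leaves room for T
    deletions and one more term. *)
Lemma hamming_weight_dvd_exp_XsubC (F : fieldType) (p : nat) (b : F)
    (u : {poly F}) (T : nat) :
    p \in [pchar F] -> b != 0 -> u != 0 -> (size u <= p)%N ->
  ('X - b%:P) ^+ T %| u -> (T < hamming_weight u)%N.
Proof.
move=> pF bn0; elim: T u => [|T IH] u un0 up bu; first by rewrite hamming_weight_gt0.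
pose v := (size u).-1; pose w := 'X * u^`() - u *+ v.
have wE i : w`_i = (i%:R - v%:R) * u`_i.
  rewrite coefB coefXM coefMn mulrBl !mulr_natl; case: i => [|i] /=.
    by rewrite mulr0n.
  by rewrite coef_deriv.
have vp : (v < p)%N by rewrite prednK ?size_poly_gt0.
have wp : (size w <= p)%N.
  apply/leq_sizeP => i pi; rewrite wE nth_default ?mulr0 //.
  exact: leq_trans pi.
have w_u i : (w`_i != 0) = (i < v)%N && (u`_i != 0).
  rewrite wE mulf_eq0 negb_or; have [iv|vi|->] := ltngtP i v; last by rewrite subrr eqxx.
    congr (_ && _); rewrite -oppr_eq0 opprB -natrB ?(ltnW iv) //.
    rewrite -(dvdn_pcharf pF) gtnNdvd ?subn_gt0 //.
    exact: leq_ltn_trans (leq_subr _ _) vp.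
  by rewrite [u`_i]nth_default ?eqxx ?andbF // -[size u]prednK ?size_poly_gt0.
have wt_u : hamming_weight u = (hamming_weight w).+1.
  have szw : (size w <= size u)%N.
    by apply/leq_sizeP => i ui; rewrite wE nth_default ?mulr0.
  rewrite (hamming_weightE (leqnn _)) (hamming_weightE szw).
  rewrite -(@prednK (size u)) ?size_poly_gt0 //.
  rewrite !big_nat_recr //= -/v w_u ltnn /= addn0 -lead_coefE lead_coef_eq0 un0 addn1.
  by congr _.+1; apply: eq_big_nat => i /andP[_ iv]; rewrite w_u iv.
have bw : ('X - b%:P) ^+ T %| w.
  have bTu : ('X - b%:P) ^+ T %| u by apply: dvdp_trans bu; rewrite exprS dvdp_mull.
  have /dvdpP[g ug] := bu.
  rewrite /w -mulr_natr dvdp_sub ?(dvdp_mulr _ bTu) // dvdp_mull // ug derivM.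
  rewrite dvdp_add // dvdp_mull //; first by rewrite exprS dvdp_mull.
  by rewrite deriv_exp derivXsubC mul1r -mulr_natr dvdp_mulr.
rewrite wt_u ltnS; apply: IH => //.
apply/eqP => w0; have u_v : u = lead_coef u *: 'X^v.
  apply/polyP => i; rewrite coefZ coefXn; have := w_u i; rewrite w0 coef0 eqxx /=.
  have [iv|vi|->] := ltngtP i v; rewrite ?mulr1 ?mulr0 //=.
    by move/esym/negbFE/eqP.
  by rewrite nth_default // -[size u]prednK ?size_poly_gt0.
have: root u b by rewrite -dvdp_XsubCl; apply: dvdp_trans bu; rewrite exprS dvdp_mulr.
by rewrite u_v /root !hornerE mulf_eq0 lead_coef_eq0 (negPf un0) expf_eq0 (negPf bn0) andbF.
Qed.

(** * Splitting exponents by residue class *)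

(** The coefficients in the residue class r modulo M.  The bound [size c] on
    the index is generous: the coefficients past the end are zero. *)
Definition polyphase (R : nzRingType) (M r : nat) (c : {poly R}) : {poly R} :=
  \poly_(l < size c) c`_(l * M + r).

Lemma coef_polyphase (R : nzRingType) (M r l : nat) (c : {poly R}) :
  (0 < M)%N -> (polyphase M r c)`_l = c`_(l * M + r).
Proof.
move=> M_gt0; rewrite coef_poly; case: ltnP => // cl; rewrite nth_default //.
by rewrite (leq_trans cl) // (leq_trans (leq_pmulr l M_gt0)) ?leq_addr.
Qed.

Lemma hamming_weight_polyphase (R : nzRingType) (M : nat) (c : {poly R}) :
    (0 < M)%N ->
  hamming_weight c = (\sum_(0 <= r < M) hamming_weight (polyphase M r c))%N.
Proof.
move=> M_gt0; rewrite (hamming_weightE (leq_pmulr (size c) M_gt0)) big_nat_mul.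
under [RHS]eq_bigr => r _ do rewrite (hamming_weightE (size_poly _ _)).
rewrite [RHS]exchange_big /=; apply: eq_bigr => l _.
rewrite mulSn -{1}[(l * M)%N]add0n big_addn addnK.
by apply: eq_bigr => r _; rewrite coef_polyphase // addnC.
Qed.

Lemma polyphaseD (R : nzRingType) (M r : nat) (c d : {poly R}) :
  (0 < M)%N -> polyphase M r (c + d) = polyphase M r c + polyphase M r d.
Proof. by move=> M_gt0; apply/polyP => l; rewrite coefD !coef_polyphase ?coefD. Qed.

(** Shifting by M moves one step inside each residue class, so 'X^M acts on
    each of them as 'X. *)
Lemma polyphase_mul_XnsubC (R : comNzRingType) (M r : nat) (b : R) (c : {poly R}) :
    (r < M)%N ->
  polyphase M r (('X^M - b%:P) * c) = ('X - b%:P) * polyphase M r c.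
Proof.
move=> rM; have M_gt0 : (0 < M)%N by apply: leq_ltn_trans rM.
apply/polyP => l; rewrite coef_polyphase // !mulrBl !coefB !coefCM coefXnM coefXM.
rewrite !coef_polyphase //; case: l => [|l] /=; first by rewrite mul0n add0n rM.
by rewrite mulSn -addnA ltnNge leq_addr /= addKn.
Qed.

Lemma polyphase_exp_XnsubC (R : comNzRingType) (M r T : nat) (b : R) (c : {poly R}) :
    (r < M)%N ->
  polyphase M r (('X^M - b%:P) ^+ T * c) = ('X - b%:P) ^+ T * polyphase M r c.
Proof.
move=> rM; elim: T => [|T IH]; first by rewrite !mul1r.
by rewrite !exprS -!mulrA polyphase_mul_XnsubC // IH.
Qed.

(** Reduction modulo 'X^M - b substitutes b for 'X^M, which is evaluation at b
    inside each residue class. *)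
Lemma coef_mod_XnsubC (F : fieldType) (M r : nat) (b : F) (c : {poly F}) :
    (r < M)%N ->
  (c %% ('X^M - b%:P))`_r = (polyphase M r c).[b].
Proof.
move=> rM; have M_gt0 : (0 < M)%N by apply: leq_ltn_trans rM.
have g_neq0 : 'X^M - b%:P != 0 by rewrite -size_poly_gt0 size_XnsubC.
rewrite [c in RHS](divp_eq _ ('X^M - b%:P)) mulrC polyphaseD // polyphase_mul_XnsubC //.
rewrite hornerD hornerM hornerXsubC subrr mul0r add0r.
have := ltn_modp c ('X^M - b%:P); rewrite g_neq0 size_XnsubC // ltnS.
move: (c %% _) => d dM.
suff -> : polyphase M r d = (d`_r)%:P by rewrite hornerC.
apply/polyP => l; rewrite coef_polyphase // coefC; case: l => [|l] //=.
by rewrite nth_default // (leq_trans dM) // mulSn -addnA leq_addr.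
Qed.

Lemma exact_power_factor (F : fieldType) (g c : {poly F}) :
    (1 < size g)%N -> c != 0 ->
  exists T h, c = g ^+ T * h /\ ~~ (g %| h).
Proof.
move=> g1; have [N] := ubnP (size c); elim: N c => // N IH c cN cn0.
have [|gc] := boolP (g %| c); last by exists 0%N, c; rewrite mul1r.
case/dvdpP => h ch.
have hn0 : h != 0 by apply: contraNneq cn0 => h0; rewrite ch h0 mul0r.
have gn0 : g != 0 by rewrite -size_poly_gt0 ltnW.
case: (IH h) => // [|T [k [hk gk]]].
  rewrite -ltnS (leq_trans _ cN) // ltnS ch size_mul // -subn1 -addnBA ?(ltnW g1) //.
  by rewrite -addn1 leq_add2l subn_gt0.
by exists T.+1, k; rewrite ch hk exprSr -mulrA [k * g]mulrC mulrA.
Qed.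

(** Each nonzero coefficient of h mod 'X^M - b marks a residue class modulo M
    which is a nonzero multiple of ('X - b)^T, hence has more than T terms. *)
Lemma hamming_weight_mul_exp_XnsubC (F : fieldType) (p M T : nat) (b : F) (h : {poly F}) :
    p \in [pchar F] -> b != 0 -> (0 < M)%N ->
    (size (('X^M - b%:P) ^+ T * h)%R <= M * p)%N ->
  (T.+1 * hamming_weight (h %% ('X^M - b%:P))%R
     <= hamming_weight (('X^M - b%:P) ^+ T * h)%R)%N.
Proof.
move=> pF bn0 M_gt0; set c := _ * h => cMp.
have g_neq0 : 'X^M - b%:P != 0 by rewrite -size_poly_gt0 size_XnsubC.
have dM : (size (h %% ('X^M - b%:P))%R <= M)%N.
  by have := ltn_modp h ('X^M - b%:P); rewrite g_neq0 size_XnsubC.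
rewrite (hamming_weightE dM) (hamming_weight_polyphase _ M_gt0) big_distrr /=.
rewrite big_nat_cond [X in (_ <= X)%N]big_nat_cond.
apply: leq_sum => r /andP[/andP[_ rM] _]; rewrite coef_mod_XnsubC //.
have [|hr] := eqVneq; first by rewrite muln0.
rewrite muln1; apply: (hamming_weight_dvd_exp_XsubC pF bn0).
- rewrite polyphase_exp_XnsubC // mulf_neq0 ?expf_neq0 ?polyXsubC_eq0 //.
  by apply: contraNneq hr => ->; rewrite horner0.
- apply/leq_sizeP => l pl; rewrite coef_polyphase // nth_default //.
  rewrite (leq_trans cMp) // (leq_trans _ (leq_addr _ _)) //.
  by rewrite mulnC leq_mul2r pl orbT.
- by rewrite polyphase_exp_XnsubC // dvdp_mulr.
Qed.

(** * Repeated-root codes over a field *)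

(** A monomial is coprime to 'X^n - a. *)
Lemma hamming_weight_gt1 (F : fieldType) (n : nat) (a : F) (d : {poly F}) :
    (0 < n)%N -> a != 0 -> d != 0 -> 'X^n - a%:P %| d ->
  (1 < hamming_weight d)%N.
Proof.
move=> n_gt0 an0 dn0 fd; rewrite ltnNge; apply/negP => d1.
pose v := (size d).-1; have vE : size d = v.+1 by rewrite prednK ?size_poly_gt0.
have d_low : (\sum_(0 <= i < v) (d`_i != 0)%R)%N == 0%N.
  move: d1; rewrite (hamming_weightE (leqnn _)) vE big_nat_recr //=.
  rewrite -lead_coefE lead_coef_eq0 dn0 addn1 ltnS leqn0; exact.
have d_mono : d = lead_coef d *: 'X^v.
  apply/polyP => i; rewrite coefZ coefXn; have [iv|vi|->] := ltngtP i v.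
  - rewrite mulr0; apply/eqP; move: d_low; rewrite big_mkord sum_nat_eq0.
    by move/forallP/(_ (Ordinal iv)); rewrite eqb0 negbK.
  - by rewrite nth_default ?mulr0 // vE.
  - by rewrite mulr1.
have f1 : (1 < size ('X^n - a%:P)%R)%N by rewrite size_XnsubC.
have: coprimep ('X^n - a%:P) d.
  rewrite d_mono coprimepZr ?lead_coef_eq0 // coprimep_expr // coprimepX.
  by rewrite /root !hornerE expr0n gtn_eqF // add0r oppr_eq0.
by move/(coprimep_dvdl fd); rewrite coprimepp gtn_eqF.
Qed.

Lemma exprB_pchar_pow (A : comNzRingType) (p r : nat) (x y : A) :
  p \in [pchar A] -> (x - y) ^+ (p ^ r) = x ^+ (p ^ r) - y ^+ (p ^ r).
Proof.
move=> pA; elim: r => [|r IH]; first by rewrite !expr1.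
by rewrite expnSr !exprM IH -!(pFrobenius_autE pA) rmorphB.
Qed.

Lemma exp_XnsubC_pchar (F : fieldType) (p n r : nat) (a : F) :
    p \in [pchar F] ->
  ('X^n - a%:P) ^+ (p ^ r) = 'X^(n * p ^ r) - (a ^+ (p ^ r))%:P.
Proof.
by move=> pF; rewrite exprB_pchar_pow ?pchar_poly // -exprM -rmorphXn.
Qed.

(** One step of the lower bound: T is the leading base-p digit of the
    multiplicity of 'X^n - a in c, and d carries the remaining digits.  Only
    a lower bound j for this multiplicity is known; it confines T from below. *)
Lemma fold_codeword (F : fieldType) (p n r j : nat) (a : F) (c : {poly F}) :
    p \in [pchar F] -> (0 < n)%N -> a != 0 -> c != 0 ->
    (size c <= n * p ^ r.+1)%N -> ('X^n - a%:P) ^+ j %| c ->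
  exists T (d : {poly F}), [/\ (T < p)%N, (j < T.+1 * p ^ r)%N,
    [&& d != 0, (size d <= n * p ^ r)%N & ('X^n - a%:P) ^+ (j - T * p ^ r) %| d]
    & (T.+1 * hamming_weight d <= hamming_weight c)%N].
Proof.
move=> pF n_gt0 an0 cn0 cs; set f := _ - _ => fc.
have p_gt0 : (0 < p)%N by rewrite prime_gt0 ?(pcharf_prime pF).
pose M := (n * p ^ r)%N; have M_gt0 : (0 < M)%N by rewrite muln_gt0 n_gt0 expn_gt0 p_gt0.
pose b := a ^+ (p ^ r); have bn0 : b != 0 by rewrite expf_neq0.
have fg : f ^+ (p ^ r) = 'X^M - b%:P by rewrite exp_XnsubC_pchar.
have fn0 : f != 0 by rewrite -size_poly_gt0 size_XnsubC.
have gsz : size ('X^M - b%:P) = M.+1 by rewrite size_XnsubC.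
have gn0 : 'X^M - b%:P != 0 by rewrite -size_poly_gt0 gsz.
have [|T [h [cE gh]]] := @exact_power_factor _ ('X^M - b%:P) c _ cn0.
  by rewrite gsz.
have cM : (size c <= M * p)%N by rewrite /M -mulnA -expnSr.
have jT : (j < T.+1 * p ^ r)%N.
  rewrite ltnNge; apply: contra gh => jT.
  have : f ^+ (T.+1 * p ^ r) %| c by apply: dvdp_trans fc; rewrite dvdp_exp2l.
  by rewrite mulnC exprM fg cE exprSr dvdp_mul2l ?expf_neq0.
exists T, (h %% ('X^M - b%:P)); split => //; last first.
- by rewrite cE (hamming_weight_mul_exp_XnsubC pF) -?cE.
- rewrite -/f; apply/and3P; split.
  + by apply: contra gh => /eqP/modp_eq0P.
  + by rewrite -/M -ltnS -gsz ltn_modp.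
  + rewrite -dvdp_mod; last first.
      by rewrite -fg dvdp_exp2l // leq_subLR -mulSnr ltnW.
    have [jl|jl] := leqP j (T * p ^ r)%N.
      by rewrite (eqP jl) expr0 dvd1p.
    move: fc; rewrite cE -fg -exprM mulnC -{1}(subnKC (ltnW jl)) exprD.
    by rewrite dvdp_mul2l ?expf_neq0.
have : (size (('X^M - b%:P) ^+ T)%R <= M * p)%N.
  by apply: leq_trans (dvdp_leq cn0 _) cM; rewrite cE dvdp_mulr.
have := size_exp ('X^M - b%:P) T; rewrite gsz /= => szT.
have -> : size (('X^M - b%:P) ^+ T) = (M * T).+1.
  by rewrite -szT prednK // size_poly_gt0 expf_neq0.
by rewrite ltn_pmul2l.
Qed.

(** The induction removes the k leading digits p - 1 of the exponent one at a
    time.  For k = 0 the leading digit T is at least i.  If T > i, then T + 1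
    is enough; if T = i, the remaining word is still a multiple of 'X^n - a,
    so it has two terms and 2 (i + 1) >= i + 2. *)
Lemma field_code_weight_ge (F : fieldType) (p n r k i : nat) (a : F) (c : {poly F}) :
    p \in [pchar F] -> (0 < n)%N -> a != 0 -> (i.+1 < p)%N -> c != 0 ->
    (size c <= n * p ^ (k + r).+1)%N ->
    ('X^n - a%:P) ^+ ((p ^ k).-1 * p ^ r.+1 + i * p ^ r).+1 %| c ->
  (i.+2 * p ^ k <= hamming_weight c)%N.
Proof.
move=> pF n_gt0 an0 ip; have p_gt0 : (0 < p)%N by apply: leq_trans ip.
have pX_gt0 l : (0 < p ^ l)%N by rewrite expn_gt0 p_gt0.
elim: k c => [|k IH] c cn0 cs fc.
  have [T [d [_ jT /and3P[dn0 _ fd] cd]]] := fold_codeword pF n_gt0 an0 cn0 cs fc.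
  rewrite muln1; apply: leq_trans cd.
  move: jT fd; rewrite mul0n add0n => jT fd.
  have iT : (i <= T)%N.
    by rewrite -ltnS -(ltn_pmul2r (pX_gt0 r)) (leq_trans _ jT).
  move: iT; rewrite leq_eqVlt => /orP[/eqP iT|iT].
    move: fd; rewrite -iT -addn1 addKn expr1 => fd.
    have := hamming_weight_gt1 n_gt0 an0 dn0 fd => d2.
    apply: (@leq_trans (i.+1 * 2)%N); last by rewrite leq_mul2l d2.
    by rewrite muln2 doubleS !ltnS -addnn leq_addr.
  apply: (@leq_trans T.+1) => //.
  by rewrite leq_pmulr // hamming_weight_gt0.
have [T [d [Tp jT /and3P[dn0 ds fd] cd]]] := fold_codeword pF n_gt0 an0 cn0 cs fc.
pose q := (p ^ (k.+1 + r))%N; rewrite -/q in jT fd.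
have qE : q = (p ^ k * p ^ r.+1)%N by rewrite /q -expnD addSnnS.
have eE : ((p ^ k.+1).-1 * p ^ r.+1 = p.-1 * q + (p ^ k).-1 * p ^ r.+1)%N.
  rewrite qE mulnA -mulnDl; congr (_ * _)%N; rewrite expnS -!subn1 mulnBl mul1n.
  by rewrite addnBA // subnK // leq_pmull.
have TE : T = p.-1.
  apply/eqP; rewrite eqn_leq -ltnS prednK // Tp /=.
  rewrite -ltnS -(ltn_pmul2r (pX_gt0 (k.+1 + r)%N)) -/q.
  by apply: leq_ltn_trans jT; rewrite eE -addnA -addnS leq_addr.
move: fd; rewrite TE eE -addnA -addnS addKn => fd.
have /IH := fd; rewrite dn0 -addSn ds => /(_ isT isT) dk.
apply: leq_trans cd; rewrite TE prednK // expnS mulnCA leq_mul2l dk orbT //.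
Qed.

(** * The residue field *)

(** The quotient ring is already a field: the t of the second hypothesis
    represents the inverse of the class of r. *)
Lemma residue_field_exists (R : comNzRingType) (I : {pred R}) :
    idealr_closed I -> (forall r, r \notin I -> exists t, t * r - 1 \in I) ->
  exists (F : fieldType) (phi : {rmorphism R -> F}),
    forall r, (phi r == 0) = (r \in I).
Proof.
move=> Icl Iinv.
pose idI := isIdealr.Build R I Icl.
pose J : idealr R := HB.pack I idI.
pose Q : comNzRingType := {ideal_quot J}.
pose pi : R -> Q := \pi_({ideal_quot J})%qT.
have pi_eq x y : (pi x == pi y) = (x - y \in I).
  exact: esym (Quotient.idealrBE J x y).
have piB : zmod_morphism pi by move=> x y; rewrite /pi !piE.
have piM : monoid_morphism pi by split=> [|x y]; rewrite /pi !piE.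
pose phi : {rmorphism R -> Q} := HB.pack pi
  (GRing.isZmodMorphism.Build _ _ pi piB) (GRing.isMonoidMorphism.Build _ _ pi piM).
have phi0 r : (phi r == 0) = (r \in I).
  by rewrite -(rmorph0 phi) [LHS]pi_eq subr0.
have Qinv (x : Q) : exists y, (x != 0) ==> (y * x == 1).
  have [->|xn0] := eqVneq x 0; first by exists 0.
  have x_repr : phi (repr x) = x by exact: reprK.
  have [|t tI] := Iinv (repr x); first by rewrite -phi0 x_repr.
  exists (phi t) => /=; rewrite -[x in _ * x]x_repr -rmorphM -(rmorph1 phi).
  by rewrite -subr_eq0 -rmorphB phi0.
pose inv (x : Q) : Q := if x == 0 then 0 else xchoose (Qinv x).
have mulVq x : x != 0 -> inv x * x = 1.
  move=> xn0; have /eqP := implyP (xchooseP (Qinv x)) xn0.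
  by rewrite /inv ifN.
have inv0 : inv 0 = 0 by rewrite /inv; case: ifPn => // /eqP.
pose F : fieldType := HB.pack Q (GRing.ComNzRing_isField.Build Q mulVq inv0).
by exists F, phi.
Qed.

(** * The maximal ideal and the socle of R *)

(** By maximality, gamma and any r outside its ideal generate the ring. *)
Lemma maximal_principal_idealr (R : finComNzRingType) (gamma : R) :
    maximal_ideal (principal_ideal gamma) ->
  idealr_closed (mem (principal_ideal gamma)) /\
  (forall r, r \notin principal_ideal gamma ->
     exists t, t * r - 1 \in principal_ideal gamma).
Proof.
case=> [[I0 Icl]] IT Imax; set I := principal_ideal gamma in I0 Icl IT Imax *.
have mulI x y : x \in I -> y * x \in I.
  by move=> xI; rewrite -[_ * _]addr0 Icl.
split.
  split=> //; apply: contra IT => I1; apply/eqP/setP => x.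
  by rewrite inE -[x]mulr1 mulI.
move=> r rI; pose J := [set x | [exists t, x - t * r \in I]].
have Jid : is_ideal J.
  split=> [|a x y]; first by rewrite inE; apply/existsP; exists 0; rewrite mul0r subr0.
  rewrite !inE => /existsP[t xI] /existsP[u yI]; apply/existsP; exists (a * t + u).
  by rewrite mulrDl opprD addrACA -mulrA -mulrBr Icl.
have IJ : I \subset J.
  by apply/subsetP => x xI; rewrite inE; apply/existsP; exists 0; rewrite mul0r subr0.
have [JI|JT] := Imax J Jid IJ.
  case/negP: rI; rewrite -JI inE; apply/existsP; exists 1.
  by rewrite mul1r subrr.
have : 1 \in J by rewrite JT inE.
rewrite inE => /existsP[t tI]; exists t.
by rewrite -opprB -mulN1r mulI.
Qed.

(** Translation by 1 permutes the cosets and raises the image of each by 1;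
    comparing the sums of the images over all cosets gives the claim.  With a
    residue field of order p^m this is what makes its characteristic p. *)
Lemma card_cosets_eq0 (R : finComNzRingType) (I : {set R}) (S : nzRingType)
    (phi : {rmorphism R -> S}) :
    (forall r, (phi r == 0) = (r \in I)) -> #|cosets I|%:R = 0 :> S.
Proof.
move=> phi0.
pose coset_of x := [set x + y | y in I].
have phi_coset x y : y \in coset_of x -> phi y = phi x.
  by case/imsetP => z zI ->; rewrite rmorphD (eqP (_ : phi z == 0)) ?addr0 ?phi0.
have coset_id x : x \in coset_of x.
  by apply/imsetP; exists 0; rewrite ?addr0 // -phi0 rmorph0.
(* Cosets are nonempty, so the default value 0 is never taken. *)
pose val (B : {set R}) := phi (odflt 0 [pick x in B]).
have valE x : val (coset_of x) = phi x.
  rewrite /val; case: pickP => [y /phi_coset //|/(_ x)]; by rewrite coset_id.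
pose shift (B : {set R}) := [set 1 + x | x in B].
have shift_coset x : shift (coset_of x) = coset_of (1 + x).
  by rewrite /shift -imset_comp; apply: eq_imset => y /=; rewrite addrA.
have shift_inj : injective shift by apply: imset_inj; apply: addrI.
have shift_im : [set shift B | B in cosets I] = cosets I.
  apply/eqP; rewrite eqEcard (card_imset _ shift_inj) leqnn andbT.
  apply/subsetP => _ /imsetP[_ /imsetP[x _ ->] ->].
  by rewrite -/(coset_of x) shift_coset imset_f.
have: \sum_(B in cosets I) val B = \sum_(B in cosets I) val B.
  by [].
rewrite -{1}shift_im big_imset /=; last by move=> x y _ _; apply: shift_inj.
under eq_bigr => B BI.
  have -> : val (shift B) = 1 + val B.
    case/imsetP: BI => x _ ->; rewrite -/(coset_of x) shift_coset !valE.
    by rewrite rmorphD rmorph1.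
  over.
by rewrite big_split /= sumr_const => /(canRL (addrK _)); rewrite subrr.
Qed.

(** An r outside the maximal ideal is invertible modulo gamma, so
    gamma^(e-1) r = 0 would force gamma^(e-1) = 0. *)
Lemma socle_annihilator (R : finComNzRingType) (gamma r : R) (e : nat) :
    maximal_ideal (principal_ideal gamma) -> nilpotency_index gamma e -> (0 < e)%N ->
  (gamma ^+ (e - 1) * r == 0) = (r \in principal_ideal gamma).
Proof.
move=> gmax [ge0 gneq0] e_gt0; have [_ ginv] := maximal_principal_idealr gmax.
apply/eqP/idP => [gr|/imsetP[x _ ->]]; last first.
  by rewrite mulrA -exprSr -addn1 subnK // ge0 mul0r.
apply/negPn/negP => /ginv[t /imsetP[x _ tr]].
have : gamma ^+ (e - 1) * (t * r - 1) = 0.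
  by rewrite tr mulrA -exprSr -addn1 subnK // ge0 mul0r.
rewrite mulrBr mulr1 mulrCA gr mulr0 sub0r => /eqP; rewrite oppr_eq0.
by apply/negP/gneq0; rewrite ltn_subrL e_gt0.
Qed.

(** * The generator of the code *)

(** The Frobenius congruence with an error term divisible by x as well as by
    p.  For x nilpotent, the factor x keeps the error nilpotent even after a
    factor gamma of p is divided out. *)
Lemma exprD_prime_pow (A : comNzRingType) (p s : nat) (x y : A) : prime p ->
  exists k, (x + y) ^+ (p ^ s) = x ^+ (p ^ s) + y ^+ (p ^ s) + p%:R * (x * k).
Proof.
move=> p_pr; have p_gt0 := prime_gt0 p_pr.
have base (u v : A) : exists k, (u + v) ^+ p = u ^+ p + v ^+ p + p%:R * (u * k).
  rewrite exprDn -(prednK p_gt0) big_ord_recr big_ord_recl /= bin0 binn.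
  rewrite subn0 subnn !expr0 !mulr1n mulr1 mul1r.
  exists (\sum_(i < p.-1) u ^+ (p - i.+2) * v ^+ i.+1 *+ ('C(p, i.+1) %/ p)).
  rewrite -!addrA; congr (_ + _); rewrite addrC; congr (_ + _).
  rewrite !mulr_sumr; apply: eq_bigr => i _; rewrite /bump /= add1n prednK //.
  have ip : (i.+1 < p)%N by rewrite -ltn_predRL.
  rewrite mulrnAr mulr_natl -mulrnA divnK; last by rewrite prime_dvd_bin.
  by rewrite mulrA -exprS subnSK.
elim: s => [|s [k IH]]; first by exists 0; rewrite !mulr0 addr0 !expr1.
set q := (p ^ s)%N in IH *.
have [k1 E1] := base (p%:R * (x * k)) (x ^+ q + y ^+ q).
have [k2 E2] := base (x ^+ q) (y ^+ q).
have [X xX] : exists X, x ^+ q = x * X.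
  by exists (x ^+ q.-1); rewrite -exprS prednK // expn_gt0 p_gt0.
pose w := p%:R * (x * k); have [Z wZ] : exists Z, w ^+ p = w * Z.
  by exists (w ^+ p.-1); rewrite -exprS prednK.
exists (k * Z + X * k2 + p%:R * k * k1).
rewrite expnSr !exprM IH addrC E1 E2 -/w wZ {2}xX /w.
ring.
Qed.

(** f is nilpotent because g is, so w - f k is a unit minus a nilpotent; its
    inverse comes from a finite geometric series. *)
Lemma exp_associate_nilpotent (A : comNzRingType) (f g w w' k : A) (q e : nat) :
    w * w' = 1 -> g ^+ e = 0 -> f ^+ q = g * (w - f * k) ->
  exists U V, U * V = 1 /\ f ^+ q = g * U.
Proof.
move=> ww' ge0 fq.
have f_nil : f ^+ (q * e) = 0 by rewrite exprM fq exprMn ge0 mul0r.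
pose z := w' * (f * k); pose N := (q * e)%N.
have zN : z ^+ N = 0 by rewrite !exprMn f_nil mul0r mulr0.
exists (w - f * k), (w' * \sum_(i < N) z ^+ i); split=> //.
rewrite mulrA mulrBl ww' -[f * k * w']mulrC -/z.
by rewrite -opprB mulNr -subrX1 zN sub0r opprK.
Qed.

Lemma mk_monic_XnsubC (A : nzRingType) (N : nat) (a : A) :
  (0 < N)%N -> mk_monic ('X^N - a%:P) = 'X^N - a%:P.
Proof. by move=> N_gt0; rewrite /mk_monic size_XnsubC // ltnS N_gt0 monicXnsubC. Qed.

Lemma in_qpoly_XnsubC (A : comNzRingType) (N : nat) (lam : A) : (0 < N)%N ->
  in_qpoly ('X^N - lam%:P) 'X^N = lam *: 1.
Proof.
move=> N_gt0; apply/val_inj => /=; rewrite mk_monic_XnsubC //.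
rewrite -[X in Pdiv.Ring.rmodp X _](subrK lam%:P) Pdiv.RingMonic.rmodpD ?monicXnsubC //.
rewrite Pdiv.RingMonic.rmodpp ?monicXnsubC // add0r Pdiv.Ring.rmodp_small.
  by rewrite -mul_polyC mulr1.
by rewrite size_XnsubC // (leq_ltn_trans (size_polyC_leq1 _)).
Qed.

Lemma constacyclic_generator_pow (R : comUnitRingType) (p s n e : nat)
    (gamma t lambda0 omega lambda : R) :
    let h := 'X^(n * p ^ s) - lambda%:P in
    prime p -> (0 < n)%N ->
    lambda = lambda0 ^+ (p ^ s) + gamma * omega -> p%:R = gamma * t -> gamma ^+ e = 0 ->
    omega \is a GRing.unit ->
  exists U V : {poly %/ h}, U * V = 1 /\
    in_qpoly h ('X^n - lambda0%:P) ^+ (p ^ s) = gamma *: U.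
Proof.
move=> h p_pr n_gt0 lambdaE p_gamma ge0 omegaU.
set f := in_qpoly h _; set q := (p ^ s)%N in lambdaE h f *.
have N_gt0 : (0 < n * q)%N by rewrite muln_gt0 n_gt0 expn_gt0 prime_gt0.
have [k] := @exprD_prime_pow _ p s ('X^n - lambda0%:P) lambda0%:P p_pr.
rewrite subrK -exprM -/q => /(congr1 (in_qpoly h)).
rewrite in_qpoly_XnsubC // !rmorphD !rmorphM !rmorphXn -/f rmorph_nat /= -/f.
have -> : in_qpoly h lambda0%:P = lambda0 *: 1.
  by rewrite -alg_polyC linearZ /= rmorph1.
rewrite exprZn expr1n; set K := in_qpoly h k => E.
have lambdaA : lambda%:A = (lambda0 ^+ q)%:A + gamma *: omega%:A :> {poly %/ h}.
  by rewrite scalerA -scalerDl; congr (_ *: _).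
have pA : p%:R = gamma *: t%:A :> {poly %/ h}.
  by rewrite scalerA -p_gamma scaler_nat.
have wV : omega%:A * omega^-1%:A = 1 :> {poly %/ h}.
  by rewrite -scalerAl mul1r scalerA divrr ?scale1r.
have g_nil : gamma%:A ^+ e = 0 :> {poly %/ h} by rewrite exprZn ge0 scale0r.
have fq : f ^+ q = gamma%:A * (omega%:A - f * (t *: K)).
  rewrite -scalerAl mul1r scalerBr -(addrK (p%:R * (f * K)) (f ^+ q)).
  congr (_ - _); last by rewrite pA -!scalerAl mul1r -scalerAr.
  by apply: (addrI (lambda0 ^+ q)%:A); rewrite -lambdaA E addrCA addrA.
have [U [V [UV fU]]] := exp_associate_nilpotent wV g_nil fq.
by exists U, V; rewrite fU -scalerAl mul1r.
Qed.

(** * Codewords and their residues *)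

Lemma val_in_qpoly (A : comNzRingType) (N : nat) (lam : A) (P : {poly A}) :
    (0 < N)%N ->
  exists Q, in_qpoly ('X^N - lam%:P) P = P - Q * ('X^N - lam%:P) :> {poly A}.
Proof.
move=> N_gt0 /=; rewrite mk_monic_XnsubC //; set h := _ - _.
exists (Pdiv.Ring.rdivp P h).
by rewrite {2}(Pdiv.RingMonic.rdivp_eq (monicXnsubC lam N_gt0) P) addrC addKr.
Qed.

(** The hypothesis on z says that the coefficients of z d which vanish are
    those of d that reduce to zero, so the support of z d is that of the
    residue of d.  The residue is a multiple of P^j since P^j also divides the
    modulus over F. *)
Lemma scaled_codeword_residue (R : comNzRingType) (F : fieldType)
    (phi : {rmorphism R -> F}) (z : R) (N j : nat) (lam : R) (P : {poly R})
    (a : {poly %/ ('X^N - lam%:P)}) :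
    (forall r, (z * r == 0) = (phi r == 0)) -> (0 < N)%N ->
    map_poly phi P ^+ j %| 'X^N - (phi lam)%:P ->
    let c := z *: (in_qpoly ('X^N - lam%:P) P ^+ j * a) in
    c != 0 ->
  exists g : {poly F}, [/\ g != 0, (size g <= N)%N, map_poly phi P ^+ j %| g
    & hamming_weight c = hamming_weight g].
Proof.
move=> z0 N_gt0 Pj c cn0; pose d := in_qpoly ('X^N - lam%:P) P ^+ j * a.
have d_size : (size d <= N)%N.
  by rewrite -ltnS (leq_trans (size_mk_monic d)) // mk_monic_XnsubC // size_XnsubC.
have cE i : c`_i = z * d`_i by rewrite poly_of_qpolyZ coefZ.
have c_g i : (c`_i != 0) = ((map_poly phi d)`_i != 0).
  by rewrite cE coef_map z0.
exists (map_poly phi d); split.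
- apply: contra cn0 => /eqP g0; apply/eqP/val_inj/polyP => i /=.
  rewrite [RHS]coef0; apply/eqP/negbNE.
  by have := c_g i; rewrite g0 coef0 eqxx => ->.
- apply: (@leq_trans (size d)) => //; apply/leq_sizeP => i di.
  by rewrite coef_map nth_default //; apply: rmorph0.
- have aE : in_qpoly ('X^N - lam%:P) (a : {poly R}) = a.
    apply/val_inj => /=; rewrite Pdiv.Ring.rmodp_small //; exact: size_mk_monic.
  have [Q] := val_in_qpoly lam (P ^+ j * a) N_gt0.
  have -> : in_qpoly ('X^N - lam%:P) (P ^+ j * a) = d.
    by rewrite rmorphM rmorphXn /= aE.
  move=> ->.
  rewrite rmorphB !rmorphM !rmorphXn /= rmorphB /= map_polyXn map_polyC /=.
  by apply: dvdp_sub; [apply: dvdp_mulr | apply: dvdp_mull].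
- by apply/eqP; rewrite eqn_leq !hamming_weight_le // => i; rewrite c_g.
Qed.

(** z only sees residues, so P^j may be replaced by any polynomial W with the
    same residue; for W of small degree the word is then the polynomial z W. *)
Lemma scaled_power_codeword (R : comNzRingType) (F : fieldType)
    (phi : {rmorphism R -> F}) (z : R) (N j : nat) (lam : R) (P W : {poly R}) :
    (forall r, (z * r == 0) = (phi r == 0)) -> (0 < N)%N -> (size W <= N)%N ->
    map_poly phi W = map_poly phi P ^+ j -> map_poly phi P != 0 ->
    let c : {poly %/ ('X^N - lam%:P)} := z *: in_qpoly ('X^N - lam%:P) P ^+ j in
  c != 0 /\ (hamming_weight c <= hamming_weight W)%N.
Proof.
move=> z0 N_gt0 WN phiW Pn0 c.
have zW : z *: W = z *: P ^+ j.
  apply/polyP => i; rewrite !coefZ; apply/eqP; rewrite -subr_eq0 -mulrBr z0 rmorphB.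
  by rewrite -!(coef_map phi) phiW [map_poly _ (_ ^+ _)]rmorphXn subrr.
have cW : z *: W = c :> {poly R}.
  rewrite /c -rmorphXn -linearZ -zW /= Pdiv.Ring.rmodp_small // mk_monic_XnsubC //.
  by rewrite size_XnsubC // ltnS (leq_trans (size_scale_leq _ _)).
split; last first.
  rewrite -cW hamming_weight_le // => i; rewrite coefZ.
  by apply: contraNneq => ->; rewrite mulr0.
apply/eqP => c0; have /negP[] : map_poly phi W != 0 by rewrite phiW expf_neq0.
apply/eqP/polyP => i; rewrite coef0 coef_map; apply/eqP.
by rewrite -z0 -coefZ cW c0 coef0.
Qed.

(** Over F the Frobenius map turns the exponents p^(r+1) and p^r into sparse
    binomials; these are lifted to R[x] by the same formula. *)
Lemma sparse_power (R : comNzRingType) (F : fieldType)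
    (phi : {rmorphism R -> F}) (p n k r i : nat) (lambda0 : R) :
    p \in [pchar F] -> (0 < n)%N -> (i < p)%N ->
  exists W : {poly R}, [/\ (size W <= n * p ^ (k + r).+1)%N,
    map_poly phi W
      = map_poly phi ('X^n - lambda0%:P) ^+ ((p ^ k).-1 * p ^ r.+1 + i * p ^ r)
    & (hamming_weight W <= i.+1 * p ^ k)%N].
Proof.
move=> pF n_gt0 ip; have p_gt0 : (0 < p)%N by apply: leq_ltn_trans ip.
have pX_gt0 l : (0 < p ^ l)%N by rewrite expn_gt0 p_gt0.
pose G l := 'X^(n * p ^ l) - (lambda0 ^+ (p ^ l))%:P.
have G_size l : size (G l) = (n * p ^ l).+1 by rewrite size_XnsubC ?muln_gt0 ?n_gt0 ?pX_gt0.
have phiG l : map_poly phi (G l) = map_poly phi ('X^n - lambda0%:P) ^+ (p ^ l).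
  rewrite !rmorphB /= !map_polyXn !map_polyC /= (exp_XnsubC_pchar _ _ _ pF).
  by rewrite rmorphXn.
exists (G r.+1 ^+ (p ^ k).-1 * G r ^+ i); split.
- have := size_poly_exp_leq (G r.+1) (p ^ k).-1.
  have := size_poly_exp_leq (G r) i; rewrite !G_size /= => s1 s2.
  apply: leq_trans (size_polyMleq _ _) _.
  apply: (@leq_trans (n * p ^ r.+1 * (p ^ k).-1 + n * p ^ r * i).+1).
    by have := leq_add s2 s1; rewrite addSn addnS; case: (_ + _)%N.
  have -> : (n * p ^ (k + r).+1 = n * p ^ r.+1 * (p ^ k).-1 + n * p ^ r.+1)%N.
    by rewrite -mulnSr prednK // -mulnA -expnD addSn addnC.
  by rewrite ltn_add2l expnSr mulnA ltn_pmul2l // muln_gt0 n_gt0 pX_gt0.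
- by rewrite rmorphM !rmorphXn /= !phiG -!exprM -exprD mulnC [(i * _)%N]mulnC.
- apply: leq_trans (hamming_weightM _ _) _; rewrite mulnC leq_mul //.
    by have := hamming_weight_exp_XnsubC (n * p ^ r) i (lambda0 ^+ (p ^ r)).
  have := hamming_weight_exp_XnsubC (n * p ^ r.+1) (p ^ k).-1 (lambda0 ^+ (p ^ r.+1)).
  by rewrite prednK.
Qed.

(** * The Hamming distance *)

Lemma hamming_distance_eq (A : finComNzRingType) (h : {poly A})
    (C : {set {poly %/ h}}) (d : nat) (c : {poly %/ h}) :
    c \in C -> c != 0 -> (hamming_weight c <= d)%N ->
    (forall c', c' \in C -> c' != 0 -> (d <= hamming_weight c')%N) ->
  hamming_distance C = d.
Proof.
move=> cC cn0 cd dC; have cC0 : c \in C :\ 0 by rewrite !inE cn0.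
rewrite /hamming_distance; case: pickP => [c0 c0C|/(_ c)]; last by rewrite cC0.
case: arg_minnP => // c1; rewrite !inE => /andP[c1n0 c1C] c1min.
by apply/eqP; rewrite eqn_leq dC // (leq_trans (c1min c cC0)).
Qed.

Lemma hamming_distance0 (A : finComNzRingType) (h : {poly A})
    (C : {set {poly %/ h}}) :
  (forall c, c \in C -> c = 0) -> hamming_distance C = 0%N.
Proof.
move=> C0; rewrite /hamming_distance; case: pickP => // c.
by rewrite !inE => /andP[/eqP cn0 /C0].
Qed.

Theorem theorem4p2
    (e p m n s : nat) (R : finComUnitRingType)
    (gamma zeta lambda0 omega lambda : R) (nu : nat)
    (he : (2 <= e)%N) (hp : prime p) (hn : (0 < n)%N) (hs : (0 < s)%N)
    (hnp : coprime n p)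
    (hchain : chain_ring R)
    (hmax : maximal_ideal (principal_ideal gamma))
    (hnil : nilpotency_index gamma e)
    (hres : #|cosets (principal_ideal gamma)| = (p ^ m)%N)
    (hzeta : (p ^ m - 1).-primitive_root zeta)
    (hlambda0 : lambda0 \in teichmuller zeta (p ^ m) :\ 0)
    (hirr : irreducible_over ('X^n - lambda0%:P))
    (homega : omega \is a GRing.unit)
    (hlambda : lambda = lambda0 ^+ (p ^ s) + gamma * omega)
    (hlambdaU : lambda \is a GRing.unit)
    (hnu : (nu <= e * p ^ s)%N)
    (C : {set constacyclic_ring R (n * p ^ s) lambda})
    (hC : C = principal_ideal
                (in_qpoly ('X^(n * p ^ s) - lambda%:P)
                          ('X^n - lambda0%:P) ^+ nu)) :
  [/\ (nu <= (e - 1) * p ^ s)%N -> hamming_distance C = 1%N,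
      forall l : nat, (l <= p - 2)%N ->
        ((e - 1) * p ^ s + l * p ^ (s - 1) + 1 <= nu)%N ->
        (nu <= (e - 1) * p ^ s + (l + 1) * p ^ (s - 1))%N ->
        hamming_distance C = (l + 2)%N,
      forall i k : nat, (1 <= i <= p - 1)%N -> (1 <= k <= s - 1)%N ->
        (e * p ^ s - p ^ (s - k) + (i - 1) * p ^ (s - k - 1) + 1 <= nu)%N ->
        (nu <= e * p ^ s - p ^ (s - k) + i * p ^ (s - k - 1))%N ->
        hamming_distance C = ((i + 1) * p ^ k)%N
    & nu = (e * p ^ s)%N -> hamming_distance C = 0%N].
Proof.
have p_gt1 := prime_gt1 hp; have p_gt0 := prime_gt0 hp.
have pX_gt0 l : (0 < p ^ l)%N by rewrite expn_gt0 p_gt0.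
have e_gt0 : (0 < e)%N by apply: leq_trans he.
have [gideal ginv] := maximal_principal_idealr hmax.
have [F [phi phi0]] := residue_field_exists gideal ginv.
have pphi : phi p%:R == 0.
  have := card_cosets_eq0 phi0; rewrite hres natrX => /eqP.
  by rewrite expf_eq0 rmorph_nat => /andP[].
have pF : p \in [pchar F] by rewrite inE hp -(rmorph_nat phi).
have [t p_gamma] : exists t, p%:R = gamma * t.
  by move: pphi; rewrite phi0 => /imsetP[t _ ->]; exists t.
pose z := gamma ^+ (e - 1).
have z0 r : (z * r == 0) = (phi r == 0) by rewrite phi0 socle_annihilator.
pose a := phi lambda0; have an0 : a != 0.
  move: hlambda0; rewrite !inE => /andP[l0 /orP[|/imsetP[i _ l0E]]].
    by rewrite (negPf l0).
  rewrite /a l0E rmorphXn expf_neq0 //; apply/eqP => z_eq0.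
  have := prim_expr_order hzeta => /(congr1 phi).
  rewrite rmorphXn z_eq0 expr0n rmorph1 gtn_eqF ?(prim_order_gt0 hzeta) //.
  by move/eqP; rewrite eq_sym oner_eq0.
pose P := 'X^n - lambda0%:P.
have phiP : map_poly phi P = 'X^n - a%:P by rewrite rmorphB /= map_polyXn map_polyC.
have phiPn0 : map_poly phi P != 0 by rewrite phiP -size_poly_gt0 size_XnsubC.
have phi_lambda : phi lambda = a ^+ (p ^ s).
  have /eqP phi_gamma : phi gamma == 0.
    by rewrite phi0; apply/imsetP; exists 1; rewrite ?mulr1.
  by rewrite hlambda rmorphD rmorphXn rmorphM phi_gamma mul0r addr0.
have [ge0 _] := hnil.
have [U [V [UV fq]]] := constacyclic_generator_pow hp hn hlambda p_gamma ge0 homega.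
set h := 'X^(n * p ^ s) - lambda%:P in C hC U V UV fq *.
pose f := in_qpoly h P; rewrite -/P -/f in fq hC.
have N_gt0 : (0 < n * p ^ s)%N by rewrite muln_gt0 hn pX_gt0.
pose t0 := ((e - 1) * p ^ s)%N.
have fz : f ^+ t0 = z *: U ^+ (e - 1) by rewrite /t0 mulnC exprM fq exprZn.
have UVX l : U ^+ l * V ^+ l = 1 by rewrite -exprMn UV expr1n.
have inC (c : {poly %/ h}) : reflect (exists x : {poly %/ h}, c = f ^+ nu * x) (c \in C).
  rewrite hC; apply: (iffP imsetP) => [[x _ ->]|[x ->]]; by exists x.
(* As V inverts U, the word z f^j is a multiple of f^(t0 + j). *)
have upper j (W : {poly R}) : (nu <= t0 + j)%N -> (size W <= n * p ^ s)%N ->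
    map_poly phi W = map_poly phi P ^+ j ->
  exists c : {poly %/ h}, [/\ c \in C, c != 0 & (hamming_weight c <= hamming_weight W)%N].
  move=> nuj Ws phiW.
  have [cn0 cW] := scaled_power_codeword lambda z0 N_gt0 Ws phiW phiPn0.
  exists (z *: f ^+ j); split=> //; apply/inC.
  exists (f ^+ (t0 + j - nu) * V ^+ (e - 1)).
  rewrite mulrA -exprD subnKC // exprD fz -!scalerAl [_ * f ^+ j]mulrC -mulrA UVX.
  by rewrite mulr1.
have lower j (c : {poly %/ h}) : (t0 + j <= nu)%N -> (j <= p ^ s)%N -> c \in C -> c != 0 ->
  exists g : {poly F}, [/\ g != 0, (size g <= n * p ^ s)%N,
    ('X^n - a%:P) ^+ j %| g & hamming_weight c = hamming_weight g].
  move=> nuj js /inC[x ->].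
  have -> : f ^+ nu * x = z *: (f ^+ j * (f ^+ (nu - (t0 + j)) * U ^+ (e - 1) * x)).
    rewrite -{1}(subnKC nuj) !exprD fz -!scalerAl; congr (_ *: _).
    by rewrite !mulrA; congr (_ * x); rewrite -mulrA mulrC.
  rewrite -phiP; apply: scaled_codeword_residue => //.
  by rewrite phi_lambda -(exp_XnsubC_pchar _ _ _ pF) phiP dvdp_exp2l.
have core k r i : s = (k + r).+1 -> (i.+1 < p)%N ->
    (t0 + ((p ^ k).-1 * p ^ r.+1 + i * p ^ r) < nu)%N ->
    (nu <= t0 + ((p ^ k).-1 * p ^ r.+1 + i.+1 * p ^ r))%N ->
  hamming_distance C = (i.+2 * p ^ k)%N.
  move=> sE ip lo hi.
  have [W [Ws phiW wtW]] := sparse_power phi k r lambda0 pF hn ip.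
  rewrite -sE in Ws; have [c [cC cn0 cW]] := upper _ _ hi Ws phiW.
  apply: (hamming_distance_eq cC cn0); first exact: leq_trans wtW.
  move=> c' c'C c'n0; rewrite -addnS in lo.
  have [|g [gn0 gs Pg ->]] := lower _ _ lo _ c'C c'n0.
    have -> : (p ^ s = (p ^ k).-1 * p ^ r.+1 + p ^ r.+1)%N.
      by rewrite -mulSnr prednK // -expnD sE addnS.
    rewrite -addnS leq_add2l (@leq_trans (i.+1 * p ^ r)) //.
      by rewrite mulSnr -addn1 leq_add2l.
    by rewrite expnS leq_mul2r ltnW ?orbT.
  by rewrite sE in gs; exact: (field_code_weight_ge pF hn an0 ip gn0 gs Pg).
split.
- move=> nut0.
  have [|||c [cC cn0 cW]] := upper 0%N 1.
  + by rewrite addn0.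
  + by rewrite size_poly1.
  + by rewrite rmorph1 expr0.
  apply: (hamming_distance_eq cC cn0).
    by apply: leq_trans cW _; rewrite /hamming_weight polyseq1 /= oner_eq0.
  by move=> c' _; rewrite -hamming_weight_gt0.
(* The remaining ranges are instances of core: k = 0 in the first one, and the
   index i counts from 0 instead of 1 in the second one. *)
- move=> l lp lo hi.
  rewrite (core 0%N (s - 1)%N l) ?muln1 ?addn2 //.
  + by rewrite add0n subn1 prednK.
  + by move: lp p_gt1; clear; lia.
  + by rewrite mul0n add0n -addn1.
  + by rewrite mul0n add0n -addn1.
- move=> [//|i] k /andP[_ ip] /andP[k_gt0 ks] lo hi.
  have sE : s = (k + (s - k - 1)).+1 by move: ks k_gt0; clear; lia.
  have skE : (s - k)%N = (s - k - 1).+1 by move: ks k_gt0; clear; lia.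
  have eE : (e * p ^ s - p ^ (s - k) = t0 + (p ^ k).-1 * p ^ (s - k - 1).+1)%N.
    have qE : (p ^ s = p ^ k * p ^ (s - k))%N.
      rewrite -expnD; congr (_ ^ _)%N.
      by move: ks; clear; lia.
    rewrite -skE -subn1 mulnBl mul1n -qE addnBA; last by rewrite leq_exp2l // leq_subr.
    by rewrite /t0 mulnBl mul1n subnK // leq_pmull.
  rewrite addn1 (core k (s - k - 1)%N i) //.
  + by move: ip p_gt1; clear; lia.
  + by move: lo; rewrite eE [(i.+1 - 1)%N]subn1 addn1 -addnA.
  + by rewrite addnA -eE.
- move=> nuE; apply: hamming_distance0 => c /inC[x ->].
  by rewrite nuE mulnC exprM fq exprZn ge0 scale0r mul0r.
Qed.
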